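(* Let $1\le k<n$ be integers. Define integers $t_k,t_{k-1},\ldots,t_1$ one by one, from $l=k$ down to $l=1$, by letting $t_l$ be the smallest integer $x$ with $1\le x\le n-l$ satisfying $$d_l(x)\leq \frac{1}{l}\sum_{i=l}^{k-1}\left(\prod_{j=l+1}^i t_j\right)d_i(t_{i+1})+\frac{1}{l}\left(\prod_{j=l+1}^k t_j\right)\delta_{k,n}$$ (the empty sum is $0$ and the empty product is $1$), where $$\delta_{k,n}:=\begin{cases}-\frac{1}{n}\sum_{j=1}^{n-1}\frac{1}{j},& k=1,\\[4pt] \frac{(n-k)!}{n!},& k>1,\end{cases}$$ and for $0\le l\le k$ the map $d_l\colon\{1,\ldots,n-l\}\to\mathbb{R}$ is $$d_l(x):=\begin{cases}-1+\frac{kx}{n}+\frac{\binom{n-x-1}{k}}{\binom{n}{k}}+\frac{x}{\binom{n}{k}}\sum_{j=1}^{x}\frac{\binom{n-j-1}{k-1}}{j},& l=0,\\[6pt] -\frac{k}{n}-\frac{1}{\binom{n}{k}}\sum_{j=1}^{x}\frac{\binom{n-j-1}{k-1}}{j},& l=1,\\[6pt] \frac{k\cdot x!\,(n-l-x)!}{l(l-1)\,n!}\sum_{j=0}^{l-2}\binom{k-1}{j}\binom{n-k}{x+l-j-1},& 1<l\le k.\end{cases}$$ Put $s_l:=t_l+l-1$ for every $1\le l\le k$. Then $(s_1,\ldots,s_k)$ is an optimal sequence.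
   Context: Binomial convention: for integers $m,j$, $\binom{m}{j}=\frac{m(m-1)\cdots(m-j+1)}{j!}$ if $j\ge 0$ and $\binom{m}{j}=0$ if $j<0$. Setting (generalized secretary problem). There are $n$ candidates with distinct ranks $1,\ldots,n$ (rank $1$ is the best) arriving in uniformly random order: all $n!$ orderings are equally likely. An ordering is a permutation $\pi$ of $\{1,\ldots,n\}$, where $\pi(i)$ is the rank of the $i$-th candidate. At time $i$ only the relative ranks of the first $i$ candidates are known. Success means selecting a candidate of rank in $\{1,\ldots,k\}$. Policy associated with a sequence. Let $(s_1,\ldots,s_k)$ be a non-decreasing sequence of integers with $l\le s_l<n$ for every $1\le l\le k$, and put $s_{k+1}:=n-1$. The policy with this sequence selects the $i_0$-th candidate, where $i_0\in\{1,\ldots,n\}$ is the smallest integer for which there is $l\in\{1,\ldots,k\}$ with (i) $s_l<i_0\le s_{l+1}$, and (ii) the $i_0$-th candidate is one of the $l$ best among the first $i_0$ candidates. If no such $i_0$ exists, it selects the $n$-th candidate. An optimal sequence is a non-decreasing sequence of integers $(s_1,\ldots,s_k)$ with $l\le s_l<n$ for every $1\le l\le k$ which maximizes, among all such sequences, the probability of success of the associated policy. *)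

(* Defs.v *)
From HB Require Import structures.
From mathcomp Require Import all_boot all_order all_algebra all_fingroup.

Set Implicit Arguments.
Unset Strict Implicit.
Unset Printing Implicit Defensive.

Import Order.TTheory GRing.Theory Num.Theory.

(* An ordering of the candidates is p : 'S_n.  Both arrival times and ranks
   are shifted by one: the candidate arriving at time i.+1 (i : 'I_n) has
   rank (p i).+1, the best candidate having rank 1.  Sequences s_1, ..., s_k
   and t_1, ..., t_k are functions nat -> nat of which only the values at
   1, ..., k are ever used. *)

Section Policy.

Variables (n k : nat) (s : nat -> nat).
Implicit Types (p : 'S_n) (i : 'I_n).

Definition among_best (l : nat) p i : bool :=
  #|[set j : 'I_n | (j <= i) && (p j <= p i)]| <= l.

Definition ext_seq (l : nat) : nat := if l == k.+1 then n.-1 else s l.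

Definition stops p i : bool :=
  [exists l : 'I_k.+1,
    [&& 0 < l, ext_seq l < i.+1 <= ext_seq l.+1 & among_best l p i]].

(* The second alternative is the default choice of the last candidate. *)
Definition selects p i : bool :=
  (stops p i && [forall j : 'I_n, (j < i) ==> ~~ stops p j])
  || ((i.+1 == n) && [forall j : 'I_n, ~~ stops p j]).

Definition success p : bool := [exists i, selects p i && ((p i).+1 <= k)].

Definition admissible : Prop :=
  (forall l, 1 <= l <= k -> l <= s l < n) /\
  (forall l m, 1 <= l -> l <= m -> m <= k -> s l <= s m).

End Policy.

Local Open Scope ring_scope.

Section Thresholds.

Variables (R : realFieldType) (n k : nat).

Definition success_prob (s : nat -> nat) : R :=
  #|[set p : 'S_n | success k s p]|%:R / #|[set: 'S_n]|%:R.

Definition optimal_seq (s : nat -> nat) : Prop :=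
  admissible n k s /\
  forall s', admissible n k s' -> success_prob s' <= success_prob s.

(* Binomial coefficients with an arbitrary integer upper argument. *)
Definition binz (m j : int) : R :=
  match j with
  | Posz j => (\prod_(i < j) (m%:~R - i%:R)) / (j`!)%:R
  | Negz _ => 0
  end.

Definition dfun (l x : nat) : R :=
  match l with
  | 0%N =>
      - 1 + k%:R * x%:R / n%:R
      + binz (n%:Z - x%:Z - 1) k%:Z / binz n%:Z k%:Z
      + x%:R / binz n%:Z k%:Z
        * \sum_(1 <= j < x.+1) binz (n%:Z - j%:Z - 1) (k%:Z - 1) / j%:R
  | 1%N =>
      - (k%:R / n%:R)
      - (binz n%:Z k%:Z)^-1
        * \sum_(1 <= j < x.+1) binz (n%:Z - j%:Z - 1) (k%:Z - 1) / j%:R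
  | _ =>
      (k%:R * (x`!)%:R * ((n - l - x)`!)%:R)
      / (l%:R * (l%:R - 1) * (n`!)%:R)
      * \sum_(0 <= j < l.-1)
          binz (k%:Z - 1) j%:Z
          * binz (n%:Z - k%:Z) (x%:Z + l%:Z - j%:Z - 1)
  end.

Definition delta : R :=
  if k == 1%N then - (n%:R^-1 * \sum_(1 <= j < n) j%:R^-1)
  else ((n - k)`!)%:R / (n`!)%:R.

Definition threshold_rhs (t : nat -> nat) (l : nat) : R :=
  l%:R^-1 * (\sum_(l <= i < k)
               (\prod_(l.+1 <= j < i.+1) (t j)%:R) * dfun i (t i.+1))
  + l%:R^-1 * (\prod_(l.+1 <= j < k.+1) (t j)%:R) * delta.

(* threshold_rhs t l involves only t_(l+1), ..., t_k, so this determines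
   t_k, ..., t_1 by descending recursion. *)
Definition thresholds (t : nat -> nat) : Prop :=
  forall l, (1 <= l <= k)%N ->
    [/\ (1 <= t l <= n - l)%N,
        dfun l (t l) <= threshold_rhs t l &
        forall x, (1 <= x <= n - l)%N -> dfun l x <= threshold_rhs t l ->
          (t l <= x)%N].

End Thresholds.

(* Main.v *)
Require Import Defs.
From mathcomp Require Import all_boot all_order all_algebra all_fingroup.
From mathcomp Require Import zify ring.

(* The relative ranks are independent of each other, and given the past the
   absolute rank of the i-th candidate depends only on its relative rank.  So
   the success probability of the policy with levels a(i) (accept at time i a
   relative rank <= a(i)) is V_0, where V_(n-1) = k/n and
     V_(i-1) = ((i - a(i)) V_i + g_i(1) + ... + g_i(a(i))) / i,
   g_i(r) being the probability that the r-th best of the first i candidates is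
   one of the k best.  While a(i) = l is constant, this recursion is solved by
     V_i = i(i-1)...(i-l+1) (l d_l(i-l) - l c) + g_i(l),
   c a constant; hence g_i(l) >= V_i iff d_l(i-l) <= c.  Gluing these solutions
   at s_(l+1) turns c into the right-hand side of the inequality defining t_l,
   so the policy stops at relative rank l iff stopping is at least as good as
   going on, which maximizes each step of the recursion. *)

Set Implicit Arguments.
Unset Strict Implicit.
Unset Printing Implicit Defensive.

Import Order.TTheory GRing.Theory Num.Theory.
Local Open Scope ring_scope.

(** * Hypergeometric probabilities *)

Section Hypergeometric.

Variable R : realFieldType.

(* The probability that a uniform i-subset of an n-set meets a given k-subset
   in exactly h points. *)
Definition hyp (n k i h : nat) : R :=
  if (h <= i)%N then 'C(k, h)%:R * 'C(n - k, i - h)%:R / 'C(n, i)%:R else 0.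

Definition cdf (n k i m : nat) : R := \sum_(h < m) hyp n k i h.

(* The probability that the r-th best of the first i of n candidates is one of
   the k best; winsum n k i l / i is the probability that the i-th candidate is
   one of the k best and has relative rank at most l. *)
Definition win (n k i r : nat) : R := 1 - cdf n k i r.

Definition winsum (n k i l : nat) : R := \sum_(1 <= r < l.+1) win n k i r.

Lemma hyp_ge0 n k i h : 0 <= hyp n k i h.
Proof. by rewrite /hyp; case: ifP => // _; rewrite divr_ge0 ?mulr_ge0. Qed.

Lemma cdf_ge0 n k i m : 0 <= cdf n k i m.
Proof. by apply: sumr_ge0 => h _; apply: hyp_ge0. Qed.

Lemma cdfS n k i m : cdf n k i m.+1 = cdf n k i m + hyp n k i m.
Proof. by rewrite /cdf big_ord_recr. Qed.

Lemma natrBC (a b : nat) : (a - b)%N%:R * 'C(a, b)%:R = (a%:R - b%:R) * 'C(a, b)%:R :> R.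
Proof.
case: (leqP b a) => ab; first by rewrite natrB.
by rewrite bin_small // !mulr0.
Qed.

Lemma bin_left (a b : nat) : b.+1%:R * 'C(a, b.+1)%:R = (a%:R - b%:R) * 'C(a, b)%:R :> R.
Proof. by rewrite -natrM mul_bin_left natrM natrBC. Qed.

(* Remove a uniformly chosen element from a random (i+1)-subset. *)
Lemma hyp_rec n k i h : (k <= n)%N -> (i < n)%N ->
  i.+1%:R * hyp n k i h =
  h.+1%:R * hyp n k i.+1 h.+1 + (i.+1%:R - h%:R) * hyp n k i.+1 h.
Proof.
move=> kn lt_in; rewrite /hyp ltnS.
case: (leqP h i) => hi; last first.
  case: (leqP h i.+1) => hi2 /=; last by rewrite !mulr0 addr0.
  have -> : h = i.+1 by lia.
  by rewrite subrr !mulr0 mul0r addr0.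
rewrite leqW // subSS (subSn hi).
have C0 : 'C(n, i)%:R != 0 :> R by rewrite pnatr_eq0 -lt0n bin_gt0 ltnW.
have C1 : 'C(n, i.+1)%:R != 0 :> R by rewrite pnatr_eq0 -lt0n bin_gt0.
have e1 := bin_left k h.
have e2 := bin_left (n - k) (i - h).
have e3 := bin_left n i.
have i0 : i.+1%:R != 0 :> R by rewrite pnatr_eq0.
have hnk : (n - k)%N%:R = n%:R - k%:R :> R by rewrite natrB.
have hih : (i - h)%N%:R = i%:R - h%:R :> R by rewrite natrB.
have hih1 : (i - h).+1%:R = i.+1%:R - h%:R :> R.
  by rewrite -[(i - h).+1]addn1 natrD hih -[i.+1]addn1 natrD; ring.
rewrite hnk hih hih1 in e2.
apply: (mulIf C0); apply: (mulIf C1).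
transitivity ((i.+1%:R * 'C(n, i.+1)%:R) * ('C(k, h)%:R * 'C(n - k, i - h)%:R) : R).
  by field.
rewrite e3.
transitivity (((h.+1%:R * 'C(k, h.+1)%:R) * 'C(n - k, i - h)%:R
   + 'C(k, h)%:R * ((i.+1%:R - h%:R) * 'C(n - k, (i - h).+1)%:R)) * 'C(n, i)%:R : R).
  by rewrite e1 e2; ring.
by field.
Qed.

(** Summing [hyp_rec] over h < m telescopes; only the boundary term at m survives. *)
Lemma cdf_rec n k i m : (k <= n)%N -> (i < n)%N ->
  i.+1%:R * cdf n k i m = i.+1%:R * cdf n k i.+1 m + m%:R * hyp n k i.+1 m.
Proof.
move=> kn lt_in; elim: m => [|m IH].
  by rewrite /cdf !big_ord0 !mulr0 mul0r addr0.
by rewrite !cdfS !mulrDr IH hyp_rec //; ring.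
Qed.

Lemma cdf_anti n k i m : (k <= n)%N -> (i < n)%N -> cdf n k i.+1 m <= cdf n k i m.
Proof.
move=> kn lt_in; rewrite -(ler_pM2l (ltr0Sn R i)) cdf_rec //.
by rewrite lerDl mulr_ge0 // hyp_ge0.
Qed.

Lemma hyp_full n k h : (k <= n)%N -> hyp n k n h = (h == k)%:R.
Proof.
move=> kn; rewrite /hyp binn divr1; case: (ltngtP h k) => hk.
- by rewrite [X in _ * X%:R]bin_small ?mulr0 ?if_same //; lia.
- by rewrite bin_small ?mul0r ?if_same.
- by rewrite hk kn !binn mulr1.
Qed.

Lemma cdf_full n k m : (k <= n)%N -> cdf n k n m = (k < m)%:R.
Proof.
move=> kn; elim: m => [|m IH]; first by rewrite /cdf big_ord0.
by rewrite cdfS IH hyp_full // -natrD; congr _%:R; lia.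
Qed.

(** Absorption in both binomials: removing a marked common point of the two subsets lowers all four
    parameters by one. *)
Lemma hyp_diag n k i h : (i <= n)%N ->
  h.+1%:R * n.+1%:R * hyp n.+1 k.+1 i.+1 h.+1 = i.+1%:R * k.+1%:R * hyp n k i h.
Proof.
move=> lein; rewrite /hyp ltnS; case: ifP => hi; last by rewrite !mulr0.
rewrite !subSS.
have C0 : 'C(n, i)%:R != 0 :> R by rewrite pnatr_eq0 -lt0n bin_gt0.
have C1 : 'C(n.+1, i.+1)%:R != 0 :> R by rewrite pnatr_eq0 -lt0n bin_gt0.
have e1 : h.+1%:R * 'C(k.+1, h.+1)%:R = k.+1%:R * 'C(k, h)%:R :> R.
  by rewrite -!natrM -mul_bin_diag.
have e2 : i.+1%:R * 'C(n.+1, i.+1)%:R = n.+1%:R * 'C(n, i)%:R :> R.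
  by rewrite -!natrM -mul_bin_diag.
apply: (mulIf C0); apply: (mulIf C1).
transitivity ((h.+1%:R * 'C(k.+1, h.+1)%:R) * 'C(n - k, i - h)%:R * (n.+1%:R * 'C(n, i)%:R) : R).
  by field; rewrite C1.
rewrite e1 -e2; field; exact: C0.
Qed.

Lemma winsum_abel n k i l :
  l%:R * win n k i l + \sum_(h < l) h%:R * hyp n k i h = winsum n k i l.
Proof.
elim: l => [|l IH]; first by rewrite big_ord0 /winsum mul0r addr0 big_geq.
rewrite /winsum big_nat_recr //= -/(winsum n k i l) -IH big_ord_recr /= /win cdfS.
by rewrite -[l.+1]addn1 natrD; ring.
Qed.

Lemma mean_trunc n k i l : (i <= n)%N ->
  n.+1%:R * \sum_(h < l.+1) h%:R * hyp n.+1 k.+1 i.+1 h =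
  i.+1%:R * k.+1%:R * cdf n k i l.
Proof.
move=> lein; rewrite big_ord_recl mul0r add0r /cdf !mulr_sumr.
apply: eq_bigr => h _; rewrite -hyp_diag //.
by rewrite mulrA [n.+1%:R * _]mulrC.
Qed.

(** [win] solves the level-l recursion up to the defect [k.+1 / n.+1 * cdf n k i l], which the
    differences of d_l will compensate. Summation by parts creates a truncated mean, evaluated by
    [mean_trunc]. *)
Lemma win_rec n k i l : (k <= n)%N -> (i <= n)%N ->
  k.+1%:R / n.+1%:R * cdf n k i l + win n.+1 k.+1 i l =
  ((i.+1%:R - l%:R) * win n.+1 k.+1 i.+1 l + winsum n.+1 k.+1 i.+1 l) / i.+1%:R.
Proof.
move=> kn lein; rewrite -winsum_abel.
have := @cdf_rec n.+1 k.+1 i l; rewrite !ltnS => /(_ kn lein) e.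
have := mean_trunc k l lein; rewrite big_ord_recr /=.
set S := \sum_(h < l) _ => e2.
have i0 : i.+1%:R != 0 :> R by rewrite pnatr_eq0.
have n0 : n.+1%:R != 0 :> R by rewrite pnatr_eq0.
apply: (mulIf i0); apply: (mulIf n0); rewrite divfK // /win.
transitivity (i.+1%:R * k.+1%:R * cdf n k i l + n.+1%:R * (i.+1%:R - i.+1%:R * cdf n.+1 k.+1 i l)).
  by field; rewrite nat1r.
by rewrite e -e2; ring.
Qed.

End Hypergeometric.

(** * The functions d_l *)

Lemma natr_ffact (R : comNzRingType) n m :
  (n ^_ m)%:R = \prod_(i < m) (n%:R - i%:R) :> R.
Proof.
elim: m => [|m IH]; first by rewrite big_ord0.
rewrite ffactnSr big_ord_recr /= -IH natrM.
case: (leqP m n) => mn; first by rewrite natrB.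
by rewrite ffact_small // !mul0r.
Qed.

Lemma binzE (R : realFieldType) (n m : nat) : binz R n m = 'C(n, m)%:R.
Proof.
rewrite /binz -natr_ffact -bin_ffact natrM mulfK //.
by rewrite pnatr_eq0 -lt0n fact_gt0.
Qed.

(** Both sides count the ordered pairs of disjoint subsets of sizes a and b of an n-set. *)
Lemma mul_bin_swap n a b :
  ('C(n - a, b) * 'C(n, a) = 'C(n - b, a) * 'C(n, b))%N.
Proof.
have small c e : (n < c + e)%N -> ('C(n - c, e) * 'C(n, c) = 0)%N.
  case: (leqP c n) => hc h; last by rewrite [X in (_ * X)%N]bin_small ?muln0.
  by rewrite bin_small //; lia.
case: (leqP (a + b) n) => h; last by rewrite !small // addnC.
have ha : (a <= n)%N by lia.
have hb : (b <= n)%N by lia.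
have ha' : (a <= n - b)%N by lia.
have hb' : (b <= n - a)%N by lia.
have ea := bin_fact ha; have eb := bin_fact hb.
have ea' := bin_fact ha'; have eb' := bin_fact hb'.
have eab : (n - a - b = n - b - a)%N by lia.
have pos : (0 < a`! * b`! * (n - b - a)`!)%N by rewrite !muln_gt0 !fact_gt0.
apply/eqP; rewrite -(eqn_pmul2r pos); apply/eqP.
transitivity (n`!); first by rewrite -ea -eb' eab; ring.
by rewrite -eb -ea'; ring.
Qed.

Section Dfun.

Variables (R : realFieldType) (n k : nat).
Hypothesis kn : (k <= n)%N.

(** There are [n.+1] candidates and [k.+1] winning ranks, because the defect in [win_rec] is a tail
    with the parameters n and k. *)
Local Notation d := (dfun R n.+1 k.+1).
Local Notation delta := (delta R n.+1 k.+1).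
Local Notation cQ := (cdf R n k).

(** For l >= 2 the sum in d_l is, up to factorials, a lower hypergeometric tail. *)
Lemma dfun_cdf m x : (x + m < n)%N ->
  m.+2%:R * m.+1%:R * n.+1%:R * ((x + m.+1) ^_ m.+1)%:R * d m.+2 x =
  k.+1%:R * cQ (x + m.+1) m.+1.
Proof.
move=> hx; rewrite /dfun -/dfun /=.
have -> : \sum_(0 <= j < m.+1) binz R (k.+1%:Z - 1) j%:Z *
     binz R (n.+1%:Z - k.+1%:Z) (x%:Z + m.+2%:Z - j%:Z - 1) =
   'C(n, x + m.+1)%:R * cQ (x + m.+1) m.+1.
  rewrite big_mkord /cdf mulr_sumr; apply: eq_bigr => j _.
  have := ltn_ord j; move: (nat_of_ord j) => {}j hj.
  rewrite /hyp ifT; last by lia.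
  have -> : k.+1%:Z - 1 = k%:Z by lia.
  have -> : n.+1%:Z - k.+1%:Z = (n - k)%N%:Z by lia.
  have -> : x%:Z + m.+2%:Z - j%:Z - 1 = (x + m.+1 - j)%N%:Z by lia.
  rewrite !binzE [RHS]mulrC divfK //.
  by rewrite pnatr_eq0 -lt0n bin_gt0; lia.
have e1 : (x`!)%:R * ((x + m.+1) ^_ m.+1)%:R = ((x + m.+1)`!)%:R :> R.
  by rewrite -natrM -(@ffact_fact (x + m.+1) m.+1) ?leq_addl // addnK mulnC.
have e2 : 'C(n, x + m.+1)%:R * (((x + m.+1)`!)%:R * ((n.+1 - m.+2 - x)`!)%:R) = (n`!)%:R :> R.
  rewrite -!natrM -(@bin_fact n (x + m.+1)); last by lia.
  by have -> : (n.+1 - m.+2 - x = n - (x + m.+1))%N by lia.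
rewrite -e1 in e2.
have nf : (n`!)%:R != 0 :> R by rewrite pnatr_eq0 -lt0n fact_gt0.
rewrite factS natrM.
have -> : m.+2%:R - 1 = m.+1%:R :> R by rewrite -addn1 natrD addrK.
rewrite -[RHS]mulr1 -(divff nf) -[X in _ = _ * (X / _)]e2; field.
by rewrite nf !nat1r -natrD !pnatr_eq0.
Qed.

(* Also covers m = 0, where both sides vanish. *)
Lemma dfun_cdf_weak m x : (x + m <= n)%N ->
  m%:R * m.+1%:R * n.+1%:R * ((x + m) ^_ m)%:R * d m.+1 x =
  k.+1%:R * cQ (x + m) m.
Proof.
case: m => [|m] hx; first by rewrite /cdf big_ord0 mulr0 !mul0r.
rewrite -dfun_cdf; last by lia.
by rewrite [m.+1%:R * _]mulrC.
Qed.

Lemma ffact_shift x m :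
  ((x + m.+1) ^_ m)%:R * x.+1%:R = (x + m.+1)%:R * ((x + m) ^_ m)%:R :> R.
Proof.
rewrite -!natrM; congr _%:R.
have -> : x.+1 = (x + m.+1 - m)%N by lia.
by rewrite -ffactnSr addnS ffactnS.
Qed.

Lemma ffactR_neq0 a b : (b <= a)%N -> (a ^_ b)%:R != 0 :> R.
Proof. by move=> h; rewrite pnatr_eq0 -lt0n ffact_gt0. Qed.

(** The difference is one summand of d_1; [mul_bin_swap] turns it into the probability that a random
    [x.+1]-subset misses the k-subset. *)
Lemma dfun1_step x : (x < n)%N ->
  n.+1%:R * x.+1%:R * (d 1 x - d 1 x.+1) = k.+1%:R * cQ x.+1 1.
Proof.
move=> hx; pose F j := binz R (n.+1%:Z - j%:Z - 1) (k.+1%:Z - 1) / j%:R.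
have eS : \sum_(1 <= j < x.+2) F j = \sum_(1 <= j < x.+1) F j + F x.+1.
  by rewrite big_nat_recr.
have eF : F x.+1 = 'C(n - x.+1, k)%:R / x.+1%:R.
  rewrite /F; have -> : n.+1%:Z - x.+1%:Z - 1 = (n - x.+1)%N%:Z by lia.
  by (have -> : k.+1%:Z - 1 = k%:Z by lia); rewrite binzE.
have dE y : d 1 y = - (k.+1%:R / n.+1%:R)
    - (binz R n.+1%:Z k.+1%:Z)^-1 * \sum_(1 <= j < y.+1) F j by [].
rewrite !dE eS eF !binzE /cdf big_ord1 /hyp leq0n bin0 mul1r subn0.
have e1 : 'C(n - x.+1, k)%:R * 'C(n, x.+1)%:R = 'C(n - k, x.+1)%:R * 'C(n, k)%:R :> R.
  by rewrite -!natrM mul_bin_swap.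
have e2 : k.+1%:R * 'C(n.+1, k.+1)%:R = n.+1%:R * 'C(n, k)%:R :> R.
  by rewrite -!natrM -mul_bin_diag.
have C0 : 'C(n, x.+1)%:R != 0 :> R by rewrite pnatr_eq0 -lt0n bin_gt0.
have C1 : 'C(n, k)%:R != 0 :> R by rewrite pnatr_eq0 -lt0n bin_gt0.
have C2 : 'C(n.+1, k.+1)%:R != 0 :> R by rewrite pnatr_eq0 -lt0n bin_gt0.
have x0 : x.+1%:R != 0 :> R by rewrite pnatr_eq0.
set S := \sum_(1 <= j < x.+1) _.
transitivity (n.+1%:R * 'C(n - x.+1, k)%:R / 'C(n.+1, k.+1)%:R : R).
  by field; rewrite C2 !nat1r !pnatr_eq0.
apply: (mulIf C0); apply: (mulIf C2); apply: (mulIf C1).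
transitivity ((n.+1%:R * 'C(n, k)%:R) * ('C(n - x.+1, k)%:R * 'C(n, x.+1)%:R) : R); first by field.
by rewrite e1 -e2; field.
Qed.

(** Up to the factor [n.+1], the right-hand side is the defect in [win_rec]. For l >= 2 both values
    of d_l are tails, compared by [cdf_rec]. *)
Lemma dfun_step l x : (0 < l)%N -> (x + l <= n)%N ->
  n.+1%:R * ((x + l) ^_ l)%:R * l%:R * (d l x - d l x.+1) = k.+1%:R * cQ (x + l) l.
Proof.
case: l => // -[|m] _ hx.
  by rewrite addn1 ffactn1 mulr1 dfun1_step //; lia.
have e1 : m.+1%:R * m.+2%:R * n.+1%:R * ((x + m.+1) ^_ m.+1)%:R * d m.+2 x = k.+1%:R * cQ (x + m.+1) m.+1.
  by apply: dfun_cdf_weak; lia.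
have e2 : m.+1%:R * m.+2%:R * n.+1%:R * ((x.+1 + m.+1) ^_ m.+1)%:R * d m.+2 x.+1 = k.+1%:R * cQ (x.+1 + m.+1) m.+1.
  by apply: dfun_cdf_weak; lia.
have hx' : (x + m.+1 < n)%N by lia.
have := cdf_rec R m.+1 kn hx'.
have e3 := ffact_shift x m.+1.
rewrite addSnnS in e2; rewrite -addnS => e4.
have e5 : ((x + m.+2) ^_ m.+2)%:R = (x + m.+2)%:R * ((x + m.+1) ^_ m.+1)%:R :> R.
  by rewrite -natrM addnS ffactnS.
have m0 : m.+1%:R != 0 :> R by rewrite pnatr_eq0.
apply: (mulIf m0); rewrite e5.
transitivity ((x + m.+2)%:R * (m.+1%:R * m.+2%:R * n.+1%:R * ((x + m.+1) ^_ m.+1)%:R * d m.+2 x)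
  - m.+1%:R * m.+2%:R * n.+1%:R * ((x + m.+2)%:R * ((x + m.+1) ^_ m.+1)%:R) * d m.+2 x.+1); first by ring.
rewrite e1 -e3.
transitivity ((x + m.+2)%:R * (k.+1%:R * cQ (x + m.+1) m.+1) - x.+1%:R * (k.+1%:R * cQ (x + m.+2) m.+1)).
  by rewrite -e2; ring.
rewrite mulrCA e4 [cQ _ m.+2]cdfS natrD.
by rewrite -[x.+1]addn1 -[m.+2]addn1 !natrD; ring.
Qed.

(** The differences in [dfun_step] are nonnegative; hence the inequality defining t_l persists
    beyond t_l. *)
Lemma dfun_anti l x y : (0 < l)%N -> (x <= y)%N -> (y + l <= n.+1)%N -> d l y <= d l x.
Proof.
move=> l0; elim: y => [|y IH]; first by rewrite leqn0 => /eqP ->.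
rewrite leq_eqVlt => /orP[/eqP -> //|]; rewrite ltnS => xy hy.
apply: le_trans (IH xy _); last by lia.
have hy' : (y + l <= n)%N by lia.
rewrite -subr_ge0 -(@pmulr_rge0 _ (n.+1%:R * ((y + l) ^_ l)%:R * l%:R)).
  by rewrite dfun_step // mulr_ge0 // cdf_ge0.
by rewrite -!natrM ltr0n !muln_gt0 ffact_gt0 leq_addl.
Qed.

(** Makes the closed forms of levels l and [l.+1] agree where they meet. The two tails involved have
    the same sample size and differ by one [hyp] term, which [hyp_diag] rewrites. *)
Lemma dfun_link l x : (0 < l)%N -> (x + l <= n)%N ->
  l.-1%:R * d l x.+1 + hyp R n.+1 k.+1 (x.+1 + l) l / ((x.+1 + l) ^_ l)%:R =
  x.+1%:R * l.+1%:R * d l.+1 x.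
Proof.
case: l => // m _ hx; rewrite -[m.+1.-1]/m.
have e1 := @dfun_cdf m x; rewrite -addnS in e1; move: e1 => /(_ hx) e1.
have e2 : m%:R * m.+1%:R * n.+1%:R * ((x.+1 + m) ^_ m)%:R * d m.+1 x.+1 = k.+1%:R * cQ (x.+1 + m) m.
  by apply: dfun_cdf_weak; lia.
have e3 := @hyp_diag R n k (x + m.+1) m hx; rewrite cdfS mulrDr in e1.
rewrite !addSnnS in e2 |- *.
rewrite -e2 in e1.
have e4 : ((x + m.+1) ^_ m.+1)%:R = ((x + m.+1) ^_ m)%:R * x.+1%:R :> R.
  by rewrite -natrM ffactnSr; congr (_ * _)%:R; lia.
have e5 : ((x + m.+2) ^_ m.+1)%:R = (x + m.+1).+1%:R * ((x + m.+1) ^_ m)%:R :> R.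
  by rewrite -natrM addnS ffactnS.
have A0 : ((x + m.+1) ^_ m)%:R != 0 :> R by apply: ffactR_neq0; lia.
rewrite e5; rewrite e4 in e1; rewrite -addnS in e3; move: A0 e1 e3.
set A := (_ ^_ _)%:R; set D := d m.+1 _; set D' := d m.+2 _.
set H := hyp _ n.+1 _ _ _; set Q := hyp _ n _ _ _.
move=> A0 e1 e3.
have x0 : (x + m.+1).+1%:R != 0 :> R by rewrite pnatr_eq0.
have n0 : n.+1%:R != 0 :> R by rewrite pnatr_eq0.
have m0 : m.+1%:R != 0 :> R by rewrite pnatr_eq0.
clear e2 e4 e5; clearbody A D D' H Q.
move: x0 e3; rewrite -addnS; move: (_ + _)%:R => X X0 e3.
apply: (mulIf m0); apply: (mulIf n0); apply: (mulIf A0).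
transitivity (m%:R * m.+1%:R * n.+1%:R * A * D + (m.+1%:R * n.+1%:R * H) / X).
  by field; exact/andP.
transitivity (m%:R * m.+1%:R * n.+1%:R * A * D + k.+1%:R * Q).
  by rewrite e3; field.
by rewrite -e1; ring.
Qed.

(** The origin of [delta]: it is the constant for which the solution at level [k.+1] ends with the
    value of the forced last choice. *)
Lemma dfun_last : k.+1%:R * d k.+1 (n - k) = delta - ((n.+1 ^_ k.+1)%:R)^-1.
Proof.
have e0 : (n.+1 ^_ k.+1)%:R * ((n - k)`!)%:R = (n.+1`!)%:R :> R.
  by rewrite -natrM -(@ffact_fact n.+1 k.+1).
have nf : (n.+1`!)%:R != 0 :> R by rewrite pnatr_eq0 -lt0n fact_gt0.
have ff : (n.+1 ^_ k.+1)%:R != 0 :> R by apply: ffactR_neq0.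
rewrite /Defs.delta eqSS; have [k0|k0] := eqVneq k 0%N.
  rewrite k0 mulr1n mul1r /dfun -/dfun subn0 !binzE bin1 ffactn1 -mulNr.
  have -> : \sum_(1 <= j < n.+1) binz R (n.+1%:Z - j%:Z - 1) (1%:Z - 1) / j%:R = \sum_(1 <= j < n.+1) j%:R^-1 :> R.
    apply: eq_big_nat => j hj; have -> : n.+1%:Z - j%:Z - 1 = (n - j)%N%:Z by lia.
    by (have -> : 1%:Z - 1 = 0%N by []); rewrite binzE bin0 mul1r.
  by ring.
rewrite subSS -e0 invfM mulrCA divff ?mulr1 ?subrr; last by rewrite pnatr_eq0 -lt0n fact_gt0.
(* At x = n - k the sample is the whole n-set, so the tail below k is 0 and d_(k+1) vanishes. *)
have := @dfun_cdf k.-1 (n - k); rewrite prednK ?lt0n // subnK // cdf_full // ltnn.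
move=> e; have {e} /eqP : n.+1%:R * (n ^_ k)%:R * k%:R * (k.+1%:R * d k.+1 (n - k)) = 0 :> R.
  by rewrite -[RHS](mulr0 k.+1%:R) -[RHS]e; [ring | lia].
rewrite mulf_eq0 => /orP[|/eqP //].
by rewrite -!natrM pnatr_eq0 !muln_eq0 /= (negPf k0) orbF => /eqP h; move: (ffact_gt0 n k); rewrite h kn.
Qed.

Lemma dfun_last_le : k.+1%:R * d k.+1 (n - k) <= delta.
Proof. by rewrite dfun_last lerBlDr lerDl invr_ge0. Qed.

(** Carries the threshold inequality from x at level [l.+1] to [x.+1] at level l. After multiplying
    by [x.+1] and using [dfun_link], the [hyp] term only helps, and d_l at x and [x.+1] remain to be
    compared. *)
Lemma dfun_exists l x : (0 < l)%N -> (x + l <= n)%N ->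
  l%:R * d l x.+1 <= d l x + x%:R * l.+1%:R * d l.+1 x.
Proof.
case: l => // m _ hx.
have e := @dfun_link m.+1 x isT hx; rewrite -[m.+1.-1]/m in e.
have x0 : 0 < x.+1%:R :> R by rewrite ltr0Sn.
rewrite -(ler_pM2l x0) mulrDr.
have -> : x.+1%:R * (x%:R * m.+2%:R * d m.+2 x) = x%:R * (x.+1%:R * m.+2%:R * d m.+2 x) :> R by ring.
rewrite -e.
set H := hyp _ _ _ _ _ / _.
have H0 : 0 <= H by rewrite divr_ge0 ?hyp_ge0.
suff : (x + m.+1)%:R * d m.+1 x.+1 <= x.+1%:R * d m.+1 x.
  move=> h; rewrite -subr_ge0 in h; rewrite -subr_ge0.
  rewrite (_ : _ - _ = x.+1%:R * d m.+1 x - (x + m.+1)%:R * d m.+1 x.+1 + x%:R * H).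
    by rewrite addr_ge0 // mulr_ge0.
  by rewrite natrD -[x.+1]addn1 -[m.+1]addn1 !natrD; ring.
(* At l = 1 the two factors coincide and monotonicity suffices; for l >= 2 the values are tails,
   ordered by [cdf_anti]. *)
case: m hx {e H H0} => [|m] hx.
  by rewrite addn1 ler_pM2l // dfun_anti //; lia.
have h1 : m.+1%:R * m.+2%:R * n.+1%:R * ((x + m.+1) ^_ m.+1)%:R * d m.+2 x = k.+1%:R * cQ (x + m.+1) m.+1.
  by apply: dfun_cdf_weak; lia.
have h2 : m.+1%:R * m.+2%:R * n.+1%:R * ((x.+1 + m.+1) ^_ m.+1)%:R * d m.+2 x.+1 = k.+1%:R * cQ (x.+1 + m.+1) m.+1.
  by apply: dfun_cdf_weak; lia.
have e3 := ffact_shift x m.+1.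
rewrite addSnnS in h2.
have c0 : 0 < m.+1%:R * m.+2%:R * n.+1%:R * ((x + m.+1) ^_ m.+1)%:R :> R.
  by rewrite !mulr_gt0 ?ltr0n ?ffact_gt0 ?leq_addl.
rewrite -(ler_pM2l c0) [leRHS]mulrCA h1.
have -> : m.+1%:R * m.+2%:R * n.+1%:R * ((x + m.+1) ^_ m.+1)%:R * ((x + m.+2)%:R * d m.+2 x.+1)
    = x.+1%:R * (k.+1%:R * cQ (x + m.+2) m.+1).
  transitivity (m.+1%:R * m.+2%:R * n.+1%:R * ((x + m.+2)%:R * ((x + m.+1) ^_ m.+1)%:R) * d m.+2 x.+1).
    by ring.
  by rewrite -h2 -e3; ring.
by rewrite !ler_pM2l ?ltr0Sn // addnS cdf_anti //; lia.
Qed.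

End Dfun.

(** * The recursion for the value of a policy *)

Lemma descending_ind (P : nat -> Prop) n :
  P n -> (forall i, (i < n)%N -> P i.+1 -> P i) -> forall i, (i <= n)%N -> P i.
Proof.
move=> Pn PS i lein; rewrite -(subKn lein); elim: (n - i)%N => [|c IH].
  by rewrite subn0.
case: (leqP n c) => hc; last by apply: PS; [lia | rewrite subnSK].
by move: IH; have -> : (n - c = n - c.+1)%N by lia.
Qed.

(** For non-decreasing s this is the largest l with s_l < i, and 0 up to s_1, where nothing is
    accepted. *)
Definition level (k : nat) (s : nat -> nat) (i : nat) : nat :=
  count (fun l => s l < i)%N (iota 1 k).

Lemma level_le k s i : (level k s i <= k)%N.
Proof. by rewrite (leq_trans (count_size _ _)) // size_iota. Qed.

Lemma level_leE k s i l :
  (forall l m, 1 <= l -> l <= m -> m <= k -> s l <= s m)%N ->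
  (1 <= l <= k)%N -> (l <= level k s i)%N = (s l < i)%N.
Proof.
move=> mono /andP[l1 lk]; rewrite /level; have [sli|lesi] := ltnP (s l) i.
  rewrite -(subnKC lk) iotaD count_cat (leq_trans _ (leq_addr _ _)) //.
  rewrite (@eq_in_count _ _ predT) ?count_predT ?size_iota //.
  move=> m; rewrite mem_iota => hm /=; apply: leq_ltn_trans sli.
  by apply: mono; lia.
have -> : k = (l.-1 + (k - l.-1))%N by lia.
rewrite iotaD count_cat [X in (_ + X)%N](@eq_in_count _ _ pred0) ?count_pred0.
  rewrite addn0; apply/negbTE; rewrite -ltnNge (leq_ltn_trans (count_size _ _)) // size_iota.
  by lia.
move=> m; rewrite mem_iota => hm /=; apply/negbTE; rewrite -leqNgt.
by apply: leq_trans lesi _; apply: mono; lia.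
Qed.

Section DynamicProgramming.

Variables (R : realFieldType) (n k : nat).
Hypothesis kn : (k < n)%N.

Local Notation d := (dfun R n.+1 k.+1).
Local Notation delta := (delta R n.+1 k.+1).
Local Notation g := (win R n.+1 k.+1).
Local Notation G := (winsum R n.+1 k.+1).
Local Notation rhs := (threshold_rhs R n.+1 k.+1).

Lemma rhs_last t : k.+1%:R * rhs t k.+1 = delta.
Proof.
rewrite /threshold_rhs !big_geq // mulr0 add0r mulr1.
by rewrite mulrA divff ?mul1r // pnatr_eq0.
Qed.

(** Splitting off t_(l+1) shows how the constant of integration changes from level [l.+1] to level
    l. *)
Lemma rhs_rec t l : (0 < l)%N -> (l <= k)%N ->
  l%:R * rhs t l = d l (t l.+1) + (t l.+1)%:R * l.+1%:R * rhs t l.+1.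
Proof.
move=> l0 lk.
have ln0 : l%:R != 0 :> R by rewrite pnatr_eq0 -lt0n.
have ln1 : l.+1%:R != 0 :> R by rewrite pnatr_eq0.
rewrite /threshold_rhs [\sum_(l <= i < k.+1) _]big_ltn // [\prod_(l.+1 <= j < l.+1) _]big_geq // mul1r.
rewrite [\prod_(l.+1 <= j < k.+2) _]big_ltn //.
have -> : \sum_(l.+1 <= i < k.+1) (\prod_(l.+1 <= j < i.+1) (t j)%:R) * d i (t i.+1)
  = (t l.+1)%:R * \sum_(l.+1 <= i < k.+1) (\prod_(l.+2 <= j < i.+1) (t j)%:R) * d i (t i.+1).
  by rewrite big_distrr /=; apply: eq_big_nat => i hi; rewrite big_ltn ?mulrA //; lia.
by field; rewrite ln0 nat1r ln1.
Qed.

Lemma eq_rhs t t' l : (forall m, (l < m)%N -> t m = t' m) -> rhs t l = rhs t' l.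
Proof.
move=> tt'; rewrite /threshold_rhs; congr (_ * _ + _ * _ * _).
  apply: eq_big_nat => i hi; rewrite tt'; last by lia.
  by congr (_ * _); apply: eq_big_nat => j hj; rewrite tt' //; lia.
by apply: eq_big_nat => j hj; rewrite tt' //; lia.
Qed.

(** Serves twice: it provides a witness for the existence of t_l, and it yields t_l <= t_(l+1) + 1,
    so that s is non-decreasing. *)
Lemma threshold_succ t l : (0 < l)%N -> (l <= k)%N ->
  (1 <= t l.+1 <= n.+1 - l.+1)%N -> d l.+1 (t l.+1) <= rhs t l.+1 ->
  d l (t l.+1).+1 <= rhs t l.
Proof.
move=> l0 lk ht hd; have ln0 : 0 < l%:R :> R by rewrite ltr0n.
rewrite -(ler_pM2l ln0) rhs_rec //.
have hx : (t l.+1 + l <= n)%N by lia.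
apply: (le_trans (dfun_exists R (ltnW kn) l0 hx)).
by rewrite lerD2l ler_wpM2l // mulr_ge0.
Qed.

Lemma thresholds_exist : exists t, thresholds R n.+1 k.+1 t.
Proof.
have [t ht] : exists t : nat -> nat, forall l, (0 < l)%N -> (l <= k.+1)%N ->
    [/\ (1 <= t l <= n.+1 - l)%N, d l (t l) <= rhs t l &
      forall x, (1 <= x <= n.+1 - l)%N -> d l x <= rhs t l -> (t l <= x)%N].
  suff H : forall m, (m <= k.+2)%N -> exists t : nat -> nat, forall l, (0 < l)%N -> (m <= l)%N -> (l <= k.+1)%N ->
    [/\ (1 <= t l <= n.+1 - l)%N, d l (t l) <= rhs t l &
      forall x, (1 <= x <= n.+1 - l)%N -> d l x <= rhs t l -> (t l <= x)%N].
    by have [t ht] := H 0 isT; exists t => l l0 lk; apply: ht.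
  (* The induction starts above the last level, where nothing is required. *)
  apply: descending_ind => [|m hm [t ht]]; first by exists id => l; lia.
  have [m0|m0] := posnP m; first by exists t => l l0 ml lk; apply: ht; lia.
  have exP : exists x, [&& 1 <= x & x <= n.+1 - m]%N && (d m x <= rhs t m).
    have [mk|mk] := leqP m k.
      have [h1 h2 _] := ht m.+1 isT (leqnn _) mk.
      exists (t m.+1).+1; rewrite threshold_succ // andbT.
      by move: h1; lia.
    have -> : m = k.+1 by lia.
    (* The largest argument allowed at the top level satisfies the inequality. *)
    exists (n - k)%N; rewrite subSS leqnn andbT subn_gt0 kn /=.
    by rewrite -(ler_pM2l (ltr0Sn R k)) rhs_last dfun_last_le // ltnW.
  case: (ex_minnP exP) => x /andP[hx1 hx2] xmin.
  exists (fun j => if j == m then x else t j) => l l0 ml lk.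
  (* The right-hand side at l >= m uses only values of t above l, so the new value at m does not
     affect it. *)
  have -> : rhs (fun j => if j == m then x else t j) l = rhs t l.
    by apply: eq_rhs => j hj; rewrite ifN //; lia.
  case: (eqVneq l m) => [->|lm]; last by apply: ht; lia.
  by split=> // y hy hdy; apply: xmin; rewrite hy.
by exists t => l /andP[l0 lk]; apply: ht.
Qed.

(* The value before time i of stopping at time i on relative ranks at most m,
   v being the value of going on. *)
Definition dpstep (i m : nat) (v : R) : R := ((i%:R - m%:R) * v + G i m) / i%:R.

(** The recursion runs on the number j of steps back from time n. At time n only the forced choice
    of the last candidate is left, which wins with probability [k.+1 / n.+1]. *)
Fixpoint polval_rev (a : nat -> nat) (j : nat) : R :=
  if j is j'.+1 then dpstep (n - j') (a (n - j')%N) (polval_rev a j')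
  else k.+1%:R / n.+1%:R.

Definition polval (a : nat -> nat) (i : nat) : R := polval_rev a (n - i).

Lemma polval_last a : polval a n = k.+1%:R / n.+1%:R.
Proof. by rewrite /polval subnn. Qed.

Lemma polval_step a i : (i < n)%N -> polval a i = dpstep i.+1 (a i.+1) (polval a i.+1).
Proof.
move=> hi; rewrite /polval -[(n - i)%N]prednK ?subn_gt0 //= -subnS.
by rewrite subKn.
Qed.

Lemma dpstep_le i m v w : (m <= i)%N -> v <= w -> dpstep i m v <= dpstep i m w.
Proof.
move=> mi vw; rewrite /dpstep ler_wpM2r ?invr_ge0 // lerD2r.
by rewrite ler_wpM2l // subr_ge0 ler_nat.
Qed.

Lemma dpstepE i m v : (0 < i)%N ->
  dpstep i m v = v + (\sum_(1 <= r < m.+1) (g i r - v)) / i%:R.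
Proof.
move=> i0; have i0' : i%:R != 0 :> R by rewrite pnatr_eq0 -lt0n.
rewrite sumrB sumr_const_nat subn1 /= /dpstep -mulr_natr -/(G i m).
by field.
Qed.

(** By [dpstepE] the step adds to v the terms g_i(r) - v of the accepted r, divided by i; level a
    collects nonnegative terms and leaves out nonpositive ones. *)
Lemma dpstep_opt i m a v : (0 < i)%N ->
  (forall r, (0 < r <= a)%N -> v <= g i r) ->
  (forall r, (a < r <= m)%N -> g i r <= v) ->
  dpstep i m v <= dpstep i a v.
Proof.
move=> i0 h1 h2; rewrite !dpstepE // lerD2l ler_wpM2r ?invr_ge0 //.
have [am|ma] := leqP a m.
  rewrite (@big_cat_nat _ _ _ a.+1 1 m.+1) //= gerDl big_nat_cond.
  by apply: sumr_le0 => r; rewrite andbT subr_le0 => hr; apply: h2.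
rewrite (@big_cat_nat _ _ _ m.+1 1 a.+1) //=; last exact: ltnW.
rewrite lerDl big_nat_cond.
by apply: sumr_ge0 => r; rewrite andbT subr_ge0 => hr; apply: h1; lia.
Qed.

Lemma win_anti i r r' : (r <= r')%N -> g i r' <= g i r.
Proof.
move=> /subnKC <-; elim: (r' - r)%N => [|c IH]; first by rewrite addn0.
by apply: le_trans IH; rewrite addnS /win cdfS lerB // lerDl hyp_ge0.
Qed.

(* The value of the policy at level l, as a solution in closed form of the
   level-l recursion; its constant of integration is the right-hand side of
   the threshold inequality. *)
Definition lval (t : nat -> nat) (l i : nat) : R :=
  (i ^_ l)%:R * (l%:R * d l (i - l) - l%:R * rhs t l) + g i l.

Lemma lval_leE t l i : (0 < l <= i)%N -> (lval t l i <= g i l) = (d l (i - l) <= rhs t l).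
Proof.
move=> /andP[l0 li]; rewrite /lval gerDr -mulrBr pmulr_rle0 ?ltr0n ?ffact_gt0 //.
by rewrite pmulr_rle0 ?ltr0n // subr_le0.
Qed.

(** The defect of [win_rec] cancels the difference from [dfun_step]; the constant passes through
    because (i+1)^_l (i+1-l) = (i+1) i^_l. *)
Lemma lval_step t l i : (0 < l <= i)%N -> (i <= n)%N ->
  lval t l i = dpstep i.+1 l (lval t l i.+1).
Proof.
move=> /andP[l0 li] lein.
have e1 := @win_rec R n k i l (ltnW kn) lein.
have e2 := @dfun_step R n k (ltnW kn) l (i - l) l0.
rewrite subnK // in e2; move: e2 => /(_ lein) e2.
have e3 : (i.+1 ^_ l)%:R * (i.+1%:R - l%:R) = i.+1%:R * (i ^_ l)%:R :> R.
  rewrite -natrB; last by lia.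
  by rewrite -!natrM -ffactnSr ffactnS.
have n0 : n.+1%:R != 0 :> R by rewrite pnatr_eq0.
have i0 : i.+1%:R != 0 :> R by rewrite pnatr_eq0.
rewrite /lval /dpstep subSn //; move: e1 e2 e3 i0.
move: (d l (i - l)) (d l (i - l).+1) (g i l) (g i.+1 l) (G _ _) (rhs _ _) => D D' g0 g1 G1 r.
move: (i ^_ l)%:R (i.+1 ^_ l)%:R i.+1%:R => A A' I e1 e2 e3 i0.
have -> : (I - l%:R) * (A' * (l%:R * D' - l%:R * r) + g1) + G1
 = (A' * (I - l%:R)) * (l%:R * D' - l%:R * r) + ((I - l%:R) * g1 + G1) by ring.
rewrite mulrDl -e1 e3 addrA; congr (_ + _).
apply: (mulIf n0).
transitivity (n.+1%:R * A * l%:R * (D - D') + n.+1%:R * A * l%:R * (D' - r)); first by ring.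
by rewrite e2; field; rewrite i0 nat1r n0.
Qed.

(** At time s_(l+1), [rhs_rec] relates the two constants and [dfun_link] the two functions. *)
Lemma lval_link t l : (0 < l <= k)%N -> (1 <= t l.+1 <= n.+1 - l.+1)%N ->
  lval t l (t l.+1 + l) = lval t l.+1 (t l.+1 + l).
Proof.
move=> /andP[l0 lk] ht; have e := rhs_rec t l0 lk.
rewrite /lval e.
have := @dfun_link R n k (ltnW kn) l (t l.+1).-1 l0; rewrite prednK; last by lia.
have hx : ((t l.+1).-1 + l <= n)%N by lia.
move=> /(_ hx); set x := t l.+1 => e2.
have -> : (x + l - l = x)%N by lia.
have -> : (x + l - l.+1 = x.-1)%N by lia.
have -> : ((x + l) ^_ l.+1)%:R = ((x + l) ^_ l)%:R * x%:R :> R.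
  by rewrite -natrM ffactnSr addnK.
have -> : g (x + l) l = g (x + l) l.+1 + hyp R n.+1 k.+1 (x + l) l.
  by rewrite /win cdfS; ring.
have A0 : ((x + l) ^_ l)%:R != 0 :> R by apply: ffactR_neq0; rewrite leq_addl.
have l1 : l.-1%:R = l%:R - 1 :> R by rewrite -subn1 natrB.
rewrite l1 in e2; have {}e2 : (l%:R - 1) * d l x + hyp R n.+1 k.+1 (x + l) l / ((x + l) ^_ l)%:R
  = x%:R * l.+1%:R * d l.+1 x.-1 by exact: e2.
move: e2 A0; move: (d l x) (d l.+1 _) (g _ _) (hyp _ _ _ _ _) (rhs _ _) => D D' g0 H r.
move: (_ ^_ _)%:R => A e2 A0.
transitivity (A * ((l%:R - 1) * D + H / A) + g0 - A * (x%:R * l.+1%:R * r)); first by field.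
by rewrite e2; ring.
Qed.

Lemma lval_last t : lval t k.+1 n = k.+1%:R / n.+1%:R.
Proof.
have e1 := @dfun_step R n k (ltnW kn) k.+1 (n - k.+1) isT.
rewrite subnK // (cdf_full R _ (ltnW kn)) ltnSn mulr1 subnSK // in e1; have {}e1 := e1 (leqnn _).
have e2 := @dfun_last R n k (ltnW kn).
have kn' : (k < n.+1)%N by apply: ltnW.
have e3 := cdf_rec R k.+1 kn' (ltnSn n).
rewrite (cdf_full R _ kn') (hyp_full R _ kn') ltnn eqxx mulr0 add0r mulr1 in e3.
have e4 : (n.+1 ^_ k.+1)%:R = n.+1%:R * (n ^_ k)%:R :> R by rewrite -natrM ffactnS.
have e5 : (n ^_ k.+1)%:R = (n ^_ k)%:R * (n%:R - k%:R) :> R.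
  by rewrite -natrB ?(ltnW kn) // -natrM ffactnSr.
have A0 : (n ^_ k)%:R != 0 :> R by apply: ffactR_neq0; apply: ltnW.
have n0 : n.+1%:R != 0 :> R by rewrite pnatr_eq0.
rewrite /lval rhs_last /win; rewrite e4 in e2; rewrite e5 in e1 *.
move: e1 e2 e3 A0; move: (d _ (n - k)) (d _ (n - k.+1)) (cdf _ _ _ _ _) delta (n ^_ k)%:R.
move=> D D' c dl A e1 e2 e3 A0; apply: (mulIf n0).
transitivity (n.+1%:R * (A * (n%:R - k%:R)) * k.+1%:R * (D' - D)
  + n.+1%:R * (A * (n%:R - k%:R)) * (k.+1%:R * D - dl) + n.+1%:R - n.+1%:R * c); first by ring.
rewrite e1 e2 e3; field.
by rewrite A0 nat1r n0.
Qed.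

(** * Optimality of the threshold levels by backward induction *)

Section Optimality.

Variable t : nat -> nat.
Hypothesis t_thr : thresholds R n.+1 k.+1 t.

Local Notation s := (fun l => t l + l - 1)%N.
Local Notation V := (polval (level k.+1 s)).

Lemma thresholds_succ l : (0 < l <= k)%N -> (t l <= (t l.+1).+1)%N.
Proof.
move=> /andP[l0 lk].
have [|h1 _ h] := @t_thr l; first by lia.
have [|h1' h2' _] := @t_thr l.+1; first by lia.
by apply: h; [lia | apply: threshold_succ].
Qed.

Lemma threshold_seq_admissible : admissible n.+1 k.+1 s.
Proof.
split=> [l hl|l m l1 lm mk]; first by have [h _ _] := t_thr hl; lia.
elim: m lm mk => [|m IH]; first by lia.
rewrite leq_eqVlt => /orP[/eqP <- //|lm] mk.
apply: leq_trans (IH _ _) _; [lia | lia |].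
by have := @thresholds_succ m; lia.
Qed.

(** For s_l <= i < s_(l+1) the next step has level l and [lval_step] applies; the right end is
    included thanks to [lval_link]. *)
Lemma polval_lval i l : (i <= n)%N -> (1 <= l <= k.+1)%N -> (s l <= i)%N ->
  (l <= k -> i <= s l.+1)%N -> V i = lval t l i.
Proof.
have [sb smono] := threshold_seq_admissible.
have link j : (0 < j <= k)%N -> lval t j (s j.+1) = lval t j.+1 (s j.+1).
  move=> hj; have [|h _ _] := @t_thr j.+1; first by lia.
  have -> : (t j.+1 + j.+1 - 1 = t j.+1 + j)%N by lia.
  exact: lval_link.
(* Several thresholds may coincide: at i0 = s_(l+1) one climbs through the levels until the next
   threshold lies strictly later. *)
have chain i0 : (forall l, (1 <= l <= k.+1)%N -> (s l <= i0)%N -> (l <= k -> i0 < s l.+1)%N -> V i0 = lval t l i0) ->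
    forall l, (1 <= l <= k.+1)%N -> (s l <= i0)%N -> (l <= k -> i0 <= s l.+1)%N -> V i0 = lval t l i0.
  move=> H l0 hl0; have [_ lk0] := andP hl0.
  move: l0 lk0 hl0; apply: descending_ind => [|{}l lk IH] hl sl1 sl2.
    by apply: H => //; lia.
  have := sl2 lk; rewrite leq_eqVlt => /orP[/eqP eqi|lti]; last by apply: H.
  rewrite [in RHS]eqi link -?eqi; last by lia.
  apply: IH; [lia | lia |].
  by move=> lk'; have := smono l.+1 l.+2; lia.
move=> lein; move: i lein l.
apply: descending_ind => [|i lt_in IH]; apply: chain => l hl sl1 sl2.
  have [lk|kl] := leqP l k; last first.
    by (have -> : l = k.+1 by lia); rewrite polval_last lval_last.
  by have := sb l.+1; have := sl2 lk; lia.
have el : level k.+1 s i.+1 = l.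
  apply/eqP; rewrite eqn_leq level_leE // ltnS sl1 andbT leqNgt.
  apply/negP => hlt; have hk := leq_trans hlt (level_le _ _ _).
  by move: hlt; rewrite level_leE // => hlt; have := sl2 hk; lia.
rewrite polval_step // el (IH l) //; last by lia.
rewrite -lval_step //; first by have := sb l; lia.
by apply: ltnW.
Qed.

(** The threshold level maximizes the step at time i, provided that the closed forms of levels not
    yet reached lie below V; [lval_le_polval] supplies this by backward induction. *)
Lemma level_opt i m : (0 < i <= n)%N -> (m < i)%N -> (m <= k.+1)%N ->
  (forall l, (1 <= l <= k.+1)%N -> (l <= i <= s l)%N -> lval t l i <= V i) ->
  dpstep i m (V i) <= V i.-1.
Proof.
have [sb smono] := threshold_seq_admissible.
move=> /andP[i0 lein] mi mk H.
have -> : V i.-1 = dpstep i (level k.+1 s i) (V i) by rewrite polval_step prednK.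
apply: dpstep_opt => // r hr.
  (* An accepted r has g_i(r) >= g_i(l), and V_i is the closed form of level l, so the inequality at
     t_l persists and gives g_i(l) >= V_i. *)
  set l := level k.+1 s i in hr.
  have hl : (1 <= l <= k.+1)%N by rewrite level_le andbT; lia.
  have sl : (s l < i)%N by rewrite -(@level_leE k.+1 s i l).
  apply: le_trans (@win_anti i r l _); last by lia.
  rewrite (@polval_lval i l) //; last first.
  - move=> lk; rewrite leqNgt -(@level_leE k.+1 s i l.+1) ?ltnn //.
  - exact: ltnW.
  have [h1 h2 _] := t_thr hl.
  rewrite lval_leE; last by lia.
  by apply: le_trans h2; apply: dfun_anti; [exact: ltnW | lia | lia | lia].
(* A rejected r has i <= s_r, so minimality of t_r puts g_i(r) below the closed form of level r. *)
have hr1 : (1 <= r <= k.+1)%N by lia.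
have isr : (i <= s r)%N.
  by rewrite leqNgt -(@level_leE k.+1 s i r) // -ltnNge; lia.
have [h1 _ h3] := t_thr hr1.
apply: le_trans (H r hr1 _); last by lia.
apply: ltW; rewrite ltNge lval_leE; last by lia.
apply/negP => /h3; lia.
Qed.

(** Before s_l the closed form keeps taking level-l steps, which [level_opt] shows to be no better
    than those of V. *)
Lemma lval_le_polval i l : (i <= n)%N -> (1 <= l <= k.+1)%N -> (l <= i <= s l)%N ->
  lval t l i <= V i.
Proof.
have [sb smono] := threshold_seq_admissible.
move=> lein; move: i lein l.
apply: descending_ind => [|i lt_in IH] l hl /andP[li]; rewrite leq_eqVlt => /orP[/eqP eqi|lti].
- by rewrite -(@polval_lval n l) //; [lia | move=> lk; have := smono l l.+1; lia].
- by have := sb l hl; lia.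
- by rewrite -(@polval_lval i l) //; [lia | lia | move=> lk; have := smono l l.+1; lia].
rewrite lval_step //; [|lia|lia].
apply: (le_trans (dpstep_le _ (IH l hl _))); [lia|lia|].
by apply: (@level_opt i.+1 l); [lia|lia|lia|exact: IH].
Qed.

Lemma polval_opt a i : (forall j, 0 < j <= n -> a j < j /\ a j <= k.+1)%N ->
  (i <= n)%N -> polval a i <= V i.
Proof.
move=> ha; move: i; apply: descending_ind => [|i lt_in IH]; first by rewrite !polval_last.
have [|h1 h2] := ha i.+1; first by lia.
rewrite [leLHS]polval_step //; apply: (le_trans (dpstep_le _ IH)); first exact: ltnW.
apply: (@level_opt i.+1) => // l hl hi; exact: lval_le_polval.
Qed.

End Optimality.

End DynamicProgramming.

(** * Symmetries of a uniform random order *)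

Section RandomOrder.

Variable n : nat.
Implicit Types (p q sg : 'S_n.+1) (i j : 'I_n.+1).

(** These permutations rearrange the first m arrivals: as the left factor acts first, [sg * p] is p
    with its arrival times permuted. *)
Definition fixes_from (m : nat) sg := [forall j : 'I_n.+1, (m <= j)%N ==> (sg j == j)].

Lemma fixes_fromP m sg : reflect (forall j, (m <= j)%N -> sg j = j) (fixes_from m sg).
Proof.
apply: (iffP forallP) => h j; first by move=> mj; apply/eqP/(implyP (h j)).
by apply/implyP => mj; apply/eqP/h.
Qed.

Lemma fixes_from_lt m sg j : fixes_from m sg -> (sg j < m)%N = (j < m)%N.
Proof.
move=> /fixes_fromP h; case: (ltnP j m) => hj; last by rewrite h // ltnNge hj.
rewrite ltnNge; apply/negP => hm; have := h _ hm; move/perm_inj => e.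
by move: hm; rewrite e leqNgt hj.
Qed.

Lemma fixes_fromM m sg tau : fixes_from m sg -> fixes_from m tau -> fixes_from m (sg * tau)%g.
Proof.
move=> /fixes_fromP h1 /fixes_fromP h2; apply/fixes_fromP => j mj.
by rewrite permM h1 // h2.
Qed.

Lemma fixes_fromV m sg : fixes_from m sg -> fixes_from m sg^-1%g.
Proof.
move=> /fixes_fromP h; apply/fixes_fromP => j mj.
by rewrite -{1}(h j mj) permK.
Qed.

Lemma card_ord_lt m : (m <= n.+1)%N -> #|[set j : 'I_n.+1 | (j < m)%N]| = m.
Proof.
move=> hm; rewrite cardsE -sum1_card.
by rewrite -(big_ord_widen_cond _ predT (fun=> 1%N) hm) sum1_card card_ord.
Qed.

(** Events determined by the relative order of the first m arrivals; [swap_inv] describes events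
    insensitive to it. *)
Definition order_inv m (E : pred 'S_n.+1) := forall p q,
  (forall j j', (j < m)%N -> (j' < m)%N -> (p j < p j')%N = (q j < q j')%N) -> E p = E q.

Definition swap_inv m (B : pred 'S_n.+1) := forall sg p, fixes_from m sg -> B (sg * p)%g = B p.

Section Standardization.

Variables (m : nat) (p : 'S_n.+1).
Hypothesis mn : (m <= n.+1)%N.

Definition pos_rank j := #|[set j' : 'I_n.+1 | (j' < m)%N && (p j' < p j)%N]|.

Lemma pos_rank_lt j : (j < m)%N -> (pos_rank j < m)%N.
Proof.
move=> hj; rewrite -[X in (_ < X)%N](card_ord_lt mn); apply: proper_card.
apply/properP; split; first by apply/subsetP => x; rewrite !inE => /andP[].
by exists j; rewrite !inE // ltnn andbF.
Qed.

Lemma pos_rank_homo j j' : (j < m)%N -> (p j < p j')%N -> (pos_rank j < pos_rank j')%N.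
Proof.
move=> hj hp; apply: proper_card; apply/properP; split.
  by apply/subsetP => x; rewrite !inE => /andP[-> /= /ltn_trans]; apply.
by exists j; rewrite !inE ?hj // ltnn andbF.
Qed.

Lemma pos_rank_mono j j' : (j < m)%N -> (j' < m)%N -> (pos_rank j < pos_rank j')%N = (p j < p j')%N.
Proof.
move=> hj hj'; case: (ltngtP (p j) (p j')) => h.
- exact: pos_rank_homo.
- by apply/negbTE; rewrite -leqNgt ltnW // pos_rank_homo.
- by rewrite (perm_inj (val_inj h)) ltnn.
Qed.

(** Replaces the first m ranks by their relative ranks. The default of [inord] never occurs, as
    [pos_rank] stays below m. *)
Definition std_fun j : 'I_n.+1 := if (j < m)%N then inord (pos_rank j) else j.

Lemma std_funE j : (j < m)%N -> std_fun j = pos_rank j :> nat.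
Proof.
by move=> hj; rewrite /std_fun hj inordK // (leq_trans (pos_rank_lt hj)).
Qed.

Lemma std_fun_inj : injective std_fun.
Proof.
move=> j j' e.
have lt_std x : (std_fun x < m)%N = (x < m)%N.
  have [hx|hx] := ltnP x m; first by rewrite std_funE // pos_rank_lt.
  by rewrite /std_fun ifN -?leqNgt // ltnNge hx.
have := lt_std j; rewrite e lt_std; have [hj|hj] := ltnP j m => hj'.
  have en : pos_rank j = pos_rank j' by rewrite -!std_funE // e.
  apply: (@perm_inj _ p); apply/val_inj => /=.
  by case: (ltngtP (p j) (p j')) => // h; [have := pos_rank_homo hj h | have := pos_rank_homo hj' h]; rewrite en ltnn.
by move: e; rewrite /std_fun hj' ltnNge hj.
Qed.

Definition std : 'S_n.+1 := perm std_fun_inj.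

Lemma std_fixes : fixes_from m std.
Proof. by apply/fixes_fromP => j mj; rewrite permE /std_fun ltnNge mj. Qed.

Lemma std_mono j j' : (j < m)%N -> (j' < m)%N -> (std j < std j')%N = (p j < p j')%N.
Proof. by move=> hj hj'; rewrite !permE !std_funE // pos_rank_mono. Qed.

End Standardization.

(* Translating by the standardization of p shows that the number of sg with
   E (sg * p) does not depend on p. *)
Lemma order_swap_count m E B : (m <= n.+1)%N -> order_inv m E -> swap_inv m B ->
  (#|[set sg | fixes_from m sg]| * #|[set p | E p && B p]| =
   #|[set p | B p]| * #|[set sg | fixes_from m sg && E sg]|)%N.
Proof.
move=> mn oE sB.
transitivity (\sum_(sg | fixes_from m sg) \sum_p (E (sg * p)%g && B p : nat))%N.
  rewrite cardsE -sum1_card big_distrl /=; apply: eq_bigr => sg hsg.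
  rewrite mul1n cardsE -sum1_card (reindex_inj (mulgI sg)) big_mkcond /=.
  by apply: eq_bigr => p _; rewrite unfold_in sB //; case: (_ && _).
rewrite exchange_big /= cardsE -sum1_card big_distrl /= [RHS]big_mkcond.
apply: eq_bigr => p _; rewrite unfold_in mul1n; case: (B p); last first.
  by rewrite big1 // => sg _; rewrite andbF.
rewrite cardsE -sum1_card [RHS](reindex_inj (mulIg (std p mn))) /=.
rewrite big_mkcond [RHS]big_mkcond; apply: eq_bigr => sg _.
rewrite unfold_in andbT.
have -> : fixes_from m (sg * std p mn)%g = fixes_from m sg.
  apply/idP/idP => h; last by apply: fixes_fromM h _; apply: std_fixes.
  by rewrite -[sg](mulgK (std p mn)); apply: fixes_fromM h _; apply/fixes_fromV/std_fixes.
case: (boolP (fixes_from m sg)) => // hsg /=.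
(* p and its standardization order the first m positions alike, and sg preserves these positions. *)
rewrite (oE (sg * p)%g (sg * std p mn)%g); first by case: (E _).
by move=> j j' hj hj'; rewrite !permM std_mono ?(fixes_from_lt _ hsg).
Qed.

(** Independence of E and B, from [order_swap_count] for B and for the full event. *)
Lemma order_swap_indep m E B : (m <= n.+1)%N -> order_inv m E -> swap_inv m B ->
  (#|[set p | E p && B p]| * #|[set: 'S_n.+1]| = #|[set p | E p]| * #|[set p | B p]|)%N.
Proof.
move=> mn oE sB; have e1 := order_swap_count mn oE sB.
have := order_swap_count mn oE (B := predT) (fun _ _ _ => erefl).
have -> : [set p | E p && predT p] = [set p | E p] by apply/setP => p; rewrite !inE andbT.
have -> : [set p | predT p] = [set: 'S_n.+1] by apply/setP => p; rewrite !inE.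
have F0 : (0 < #|[set sg | fixes_from m sg]|)%N.
  by apply/card_gt0P; exists 1%g; rewrite inE; apply/fixes_fromP => j _; rewrite perm1.
move=> e2; apply/eqP; rewrite -(eqn_pmul2l F0); apply/eqP.
rewrite mulnA e1 [RHS]mulnA e2; ring.
Qed.

(** Exchangeability: swapping arrivals i and j makes the count for i equal to that for each j in A;
    then exchange the sums. *)
Lemma tperm_count (A : pred 'I_n.+1) (Phi : 'S_n.+1 -> pred 'I_n.+1) i :
  (forall p j, A j -> Phi (tperm i j * p)%g i = Phi p j) ->
  (#|[set j | A j]| * #|[set p | Phi p i]| = \sum_p #|[set j | A j && Phi p j]|)%N.
Proof.
move=> hPhi.
transitivity (\sum_(j | A j) \sum_p (Phi p j : nat))%N.
  rewrite cardsE -sum1_card big_distrl /=; apply: eq_bigr => j Aj.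
  rewrite mul1n cardsE -sum1_card big_mkcond (reindex_inj (mulgI (tperm i j))).
  by apply: eq_bigr => p _; rewrite unfold_in hPhi //; case: (Phi p j).
rewrite exchange_big; apply: eq_bigr => p _.
rewrite cardsE -sum1_card big_mkcond [RHS]big_mkcond; apply: eq_bigr => j _.
by rewrite unfold_in; case: (A j) => //=; case: (Phi p j).
Qed.

Lemma card_perm_filter (P Q : pred 'I_n.+1) sg : (forall j, P (sg j) = P j) ->
  #|[set j | P j && Q (sg j)]| = #|[set j | P j && Q j]|.
Proof.
move=> hP; rewrite !cardsE -!sum1_card [RHS](reindex_inj (@perm_inj _ sg)).
by apply: eq_bigl => j; rewrite !unfold_in hP.
Qed.

(** Induction on the size of A, removing the element of largest f: its rank is the size of A, and
    the other ranks do not change. *)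
Lemma card_rank_le (f : 'I_n.+1 -> nat) (A : {set 'I_n.+1}) l : injective f ->
  #|[set j in A | #|[set j' in A | f j' <= f j]| <= l]|%N = minn l #|A|.
Proof.
move=> f_inj; move: {2}#|A| (erefl #|A|) => c; elim: c A => [|c IH] A hA.
  rewrite hA minn0; apply/eqP; rewrite cards_eq0 -subset0.
  by apply/subsetP => j; rewrite !inE (cards0_eq hA) inE.
have [j0 j0A] : exists j, j \in A by apply/card_gt0P; rewrite hA.
case: (arg_maxnP f j0A) => m mA mmax; have {}mA : m \in A by [].
have {}mmax j : j \in A -> (f j <= f m)%N by exact: mmax.
have hAm : #|A :\ m| = c by have := cardsD1 m A; rewrite mA hA => -[].
have rk_m : [set j' in A | (f j' <= f m)%N] = A.
  by apply/setP => j; rewrite !inE; case: (boolP (j \in A)) => //= /mmax.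
have rk j : j \in A :\ m -> [set j' in A :\ m | (f j' <= f j)%N] = [set j' in A | (f j' <= f j)%N].
  rewrite !inE => /andP[jm jA]; apply/setP => j'; rewrite !inE.
  case: eqVneq => //= ->; apply/esym/negbTE; rewrite mA /= -ltnNge ltn_neqAle (mmax _ jA) andbT.
  by apply: contra jm => /eqP /f_inj ->.
rewrite (cardsD1 m) inE mA /= rk_m hA.
have -> : [set j in A | #|[set j' in A | f j' <= f j]| <= l]%N :\ m
   = [set j in A :\ m | #|[set j' in A :\ m | f j' <= f j]| <= l]%N.
  apply/setP => j; rewrite !inE; case: (boolP (j \in A :\ m)) => hj.
    by rewrite -rk //; move: hj; rewrite !inE => /andP[-> ->].
  by move: hj; rewrite !inE; case: (j == m) => //= /negbTE ->.
rewrite IH // hAm; case: (leqP c.+1 l); lia.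
Qed.

End RandomOrder.

(** * Distribution of the number of winning candidates seen *)

Section Counting.

Variables (R : realFieldType) (n K : nat).
Hypothesis Kn : (K <= n.+1)%N.
Implicit Types (p sg : 'S_n.+1) (i j : 'I_n.+1).

Local Notation T := (#|[set: 'S_n.+1]|%:R : R).

Definition nbest K (i : nat) p := #|[set j : 'I_n.+1 | (j < i)%N && (p j < K)%N]|.

Lemma nbest_full p : nbest K n.+1 p = K.
Proof.
rewrite /nbest -[RHS](card_ord_lt Kn).
transitivity #|[set j : 'I_n.+1 | (j < n.+1)%N && (j < K)%N]|.
  by apply: (@card_perm_filter _ _ (fun j => (j < K)%N) p) => j; rewrite !ltn_ord.
by apply: eq_card => j; rewrite !inE ltn_ord.
Qed.

Lemma nbestS K' i p : nbest K' i.+1 p = (nbest K' i p + (p i < K'))%N.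
Proof.
rewrite /nbest (cardsD1 i) inE ltnSn /= addnC; congr (_ + _)%N.
by apply: eq_card => j; rewrite !inE ltnS [(j < i)%N]ltn_neqAle andbA.
Qed.

Lemma nbest_perm K' (i : nat) sg p : (forall j, (sg j < i)%N = (j < i)%N) ->
  nbest K' i (sg * p)%g = nbest K' i p.
Proof.
move=> h; rewrite -[RHS](@card_perm_filter _ _ _ sg) //.
by apply: eq_card => j; rewrite !inE permM.
Qed.

Lemma tperm_lt i j x : (j < i.+1)%N -> (tperm i j x < i.+1)%N = (x < i.+1)%N.
Proof. by move=> hj; case: tpermP => [->|->|//]; rewrite hj ltnSn. Qed.

Lemma nbest_best_count i h :
  (i.+1 * #|[set p | (nbest K i.+1 p == h) && (p i < K)%N]| =
   h * #|[set p | nbest K i.+1 p == h]|)%N.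
Proof.
rewrite -[X in (X * _)%N](card_ord_lt (ltn_ord i)).
rewrite (tperm_count (Phi := fun p j => (nbest K i.+1 p == h) && (p j < K)%N)); last first.
  move=> p j hj; rewrite nbest_perm ?permM ?tpermL // => x.
  by apply: tperm_lt.
rewrite mulnC -sum1dep_card big_distrl /= [RHS]big_mkcond; apply: eq_bigr => p _.
rewrite mul1n; case: eqP => [<-|_].
  by apply: eq_card => j; rewrite !inE.
by apply: eq_card0 => j; rewrite !inE andbF.
Qed.

(** Descending induction from the full sample: dropping the latest arrival mirrors [hyp_rec], as
    that arrival is equally likely to be any of those present. *)
Lemma nbest_dist (i h : nat) : (i <= n.+1)%N ->
  #|[set p | nbest K i p == h]|%:R = T * hyp R n.+1 K i h.
Proof.
move=> lein; move: i lein h; apply: descending_ind => [|i lt_in IH] h.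
  rewrite hyp_full //; case: eqVneq => [->|hK].
    by rewrite mulr1; congr _%:R; apply: eq_card => p; rewrite !inE nbest_full eqxx.
  rewrite mulr0 (_ : [set p | _] = set0) ?cards0 //.
  by apply/setP => p; rewrite !inE nbest_full eq_sym (negPf hK).
have i0 : i.+1%:R != 0 :> R by rewrite pnatr_eq0.
apply: (mulfI i0); rewrite mulrCA hyp_rec // mulrDr.
rewrite [T * (_ * _)]mulrCA [T * (_ * _)]mulrCA -!IH.
have e1 := nbest_best_count (Ordinal lt_in) h.+1.
have e2 := nbest_best_count (Ordinal lt_in) h.
have e3 : #|[set p | nbest K i.+1 p == h]| =
  (#|[set p | (nbest K i.+1 p == h) && (p (Ordinal lt_in) < K)%N]| +
   #|[set p | (nbest K i.+1 p == h) && ~~ (p (Ordinal lt_in) < K)%N]|)%N.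
  rewrite -cardsUI [X in (_ + X)%N](_ : _ = 0%N) ?addn0.
    by apply: eq_card => p; rewrite !inE -andb_orr orbN andbT.
  by apply: eq_card0 => p; rewrite !inE; case: (_ < _)%N; rewrite ?andbF.
have e4 : #|[set p | nbest K i p == h]| =
  (#|[set p | (nbest K i.+1 p == h.+1) && (p (Ordinal lt_in) < K)%N]| +
   #|[set p | (nbest K i.+1 p == h) && ~~ (p (Ordinal lt_in) < K)%N]|)%N.
  rewrite -cardsUI [X in (_ + X)%N](_ : _ = 0%N) ?addn0.
    apply: eq_card => p; rewrite !inE (nbestS _ (Ordinal lt_in)) /=.
    by case: (_ < _)%N; rewrite ?addn1 ?addn0 ?eqSS ?andbT ?andbF ?orbF.
  by apply: eq_card0 => p; rewrite !inE; case: (_ < _)%N; rewrite ?andbF.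
have {}e1 := congr1 (fun m => m%:R : R) e1.
have {}e2 := congr1 (fun m => m%:R : R) e2.
rewrite /= !natrM in e1 e2.
rewrite mulrBl -e1 -e2 e4 e3 !natrD; ring.
Qed.

(** min(l, h) counts the r in 1, ..., l with r <= h, and [win] is the probability of that event. *)
Lemma sum_min_nbest (i l : nat) : (i <= n.+1)%N ->
  \sum_p (minn l (nbest K i p))%:R = T * winsum R n.+1 K i l.
Proof.
move=> lein.
have minE h : (minn l h)%:R = \sum_(1 <= r < l.+1) (1 - (h < r)%N%:R) :> R.
  elim: l => [|m IH]; first by rewrite min0n big_geq.
  rewrite big_nat_recr //= -IH; case: (ltnP h m.+1) => hm.
    by rewrite subrr addr0; congr _%:R; lia.
  by rewrite subr0 -[1]/(1%:R) -natrD; congr _%:R; lia.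
under eq_bigr => p _ do rewrite minE.
rewrite exchange_big /winsum mulr_sumr; apply: eq_bigr => r _.
rewrite sumrB /win mulrBr mulr1; congr (_ - _).
  by rewrite sumr_const cardsT.
rewrite /cdf mulr_sumr.
under [RHS]eq_bigr => h _ do rewrite -nbest_dist // -sum1dep_card natr_sum big_mkcond.
rewrite exchange_big; apply: eq_bigr => p _ /=.
have [hr|hr] := ltnP (nbest K i p) r.
  rewrite (bigD1 (Ordinal hr)) //= eqxx big1 ?addr0 // => h.
  by rewrite -val_eqE eq_sym /= => /negPf ->.
rewrite big1 // => h _; case: eqP => // e.
by have := ltn_ord h; rewrite -e ltnNge hr.
Qed.

(** By exchangeability, count the suitable arrivals among all [i.+1]. A winner is preceded in rank
    only by winners, so [card_rank_le] applies within the winners. *)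
Lemma accept_count_nat i l :
  (i.+1 * #|[set p | among_best l p i && (p i < K)%N]| = \sum_p minn l (nbest K i.+1 p))%N.
Proof.
rewrite -[X in (X * _)%N](card_ord_lt (ltn_ord i)).
rewrite (tperm_count (Phi := fun p j =>
  (#|[set j' : 'I_n.+1 | (j' < i.+1)%N && (p j' <= p j)%N]| <= l)%N && (p j < K)%N)); last first.
  move=> p j hj; rewrite permM tpermL; congr ((_ <= _)%N && _).
  rewrite -[RHS](@card_perm_filter _ _ _ (tperm i j)); last by move=> x; apply: tperm_lt.
  by apply: eq_card => x; rewrite !inE permM.
apply: eq_bigr => p _; rewrite /nbest -(@card_rank_le n (fun j => p j)); last first.
  by move=> x y /val_inj /perm_inj.
apply: eq_card => j; rewrite !inE; case: (j < i.+1)%N => //=.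
rewrite andbC; case: (ltnP (p j) K) => //= hK.
congr (_ <= _)%N; apply: eq_card => x; rewrite !inE.
by case: (leqP (p x) (p j)) => h; rewrite ?andbF // (leq_ltn_trans h hK) !andbT.
Qed.

Lemma accept_count i l :
  i.+1%:R * #|[set p | among_best l p i && (p i < K)%N]|%:R = T * winsum R n.+1 K i.+1 l.
Proof. by rewrite -natrM accept_count_nat natr_sum sum_min_nbest. Qed.

End Counting.

Lemma among_best_count n (i : 'I_n.+1) l : (l <= i.+1)%N ->
  (i.+1 * #|[set p : 'S_n.+1 | among_best l p i]| = l * #|[set: 'S_n.+1]|)%N.
Proof.
move=> li; have := accept_count_nat n.+1 i l.
have -> : [set p : 'S_n.+1 | among_best l p i && (p i < n.+1)%N] = [set p | among_best l p i].
  by apply/setP => p; rewrite !inE ltn_ord andbT.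
move=> ->; rewrite mulnC cardsT -sum_nat_const; apply: eq_bigr => p _.
rewrite /nbest.
have -> : [set j : 'I_n.+1 | (j < i.+1)%N && (p j < n.+1)%N] = [set j : 'I_n.+1 | (j < i.+1)%N].
  by apply/setP => j; rewrite !inE ltn_ord andbT.
by rewrite card_ord_lt //; lia.
Qed.

(** * Success probability of a policy *)

(** The algebra of one step of the recursion: x, b, y count orderings not stopped before, those that
    stop now, and those that stop now and win; C and B are the unconditional counts of acceptance
    and of winning acceptance. *)
Lemma conditional_step (F : fieldType) (t M A C B W V x b y : F) :
  t != 0 -> M != 0 -> M * C = A * t -> M * B = t * W ->
  b * t = x * C -> y * t = x * B ->
  (x - b) * V + y = x * (((M - A) * V + W) / M).
Proof.
move=> t0 M0 c1 c2 i1 i2; apply: (mulIf t0); apply: (mulIf M0).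
transitivity ((x * t - b * t) * V * M + y * t * M); first by ring.
rewrite i1 i2; transitivity (x * t * V * M - x * (M * C) * V + x * (M * B)); first by ring.
by rewrite c1 c2; field.
Qed.

Section SuccessCount.

Variables (R : realFieldType) (n k : nat) (s : nat -> nat).
Hypotheses (kn : (k < n)%N) (s_adm : admissible n.+1 k.+1 s).
Implicit Types (p sg : 'S_n.+1) (i j : 'I_n.+1).

Local Notation a := (level k.+1 s).
Local Notation stops := (stops k.+1 s).

Lemma level_lt (i : nat) : (0 < i)%N -> (a i < i)%N.
Proof.
have [sb smono] := s_adm; move=> i0; have [-> //|l0] := posnP (a i).
have hl : (1 <= a i <= k.+1)%N by rewrite l0 level_le.
have := sb _ hl; have : (s (a i) < i)%N by rewrite -(@level_leE k.+1).
by move=> h /andP[h' _]; apply: leq_ltn_trans h.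
Qed.

Lemma among_best0 p i : among_best 0 p i = false.
Proof.
apply/negbTE; rewrite -ltnNge; apply/card_gt0P; exists i.
by rewrite inE !leqnn.
Qed.

(** The interval containing [i.+1] is unique and given by [level]. Since [ext_seq] ends at n, the
    last candidate is chosen only by default. *)
Lemma stopsE p i : stops p i = (i < n)%N && among_best (a i.+1) p i.
Proof.
have [sb smono] := s_adm.
apply/existsP/andP => [[l /and3P[l0 hl am]] | [hi am]].
  have lk : (l <= k.+1)%N by rewrite -ltnS.
  have hl1 : (1 <= l <= k.+1)%N by rewrite l0.
  move: hl; rewrite /ext_seq ltn_eqF // eqSS.
  case: eqP => [el|nl] /andP[h1 h2].
    split=> //; suff -> : a i.+1 = l by [].
    by apply/eqP; rewrite eqn_leq level_leE // h1 andbT el level_le.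
  have hl2 : (1 <= l.+1 <= k.+1)%N by lia.
  split; first by have := sb _ hl2; lia.
  suff -> : a i.+1 = l by [].
  apply/eqP; rewrite eqn_leq level_leE // h1 andbT leqNgt level_leE //.
  by rewrite -leqNgt.
have l0 : (0 < a i.+1)%N.
  by rewrite lt0n; apply/eqP => e; move: am; rewrite e among_best0.
have lk := level_le k.+1 s i.+1.
exists (inord (a i.+1)); rewrite inordK // l0 am andbT /= /ext_seq ltn_eqF // eqSS.
have hl : (1 <= a i.+1 <= k.+1)%N by rewrite l0.
rewrite -(@level_leE k.+1 s i.+1) // leqnn /=.
case: eqP => // nl.
have hl2 : (1 <= (a i.+1).+1 <= k.+1)%N by lia.
by rewrite leqNgt -(@level_leE k.+1 s i.+1) // ltnn.
Qed.

Definition no_stop (m : nat) p := [forall j : 'I_n.+1, (j < m)%N ==> ~~ stops p j].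

Lemma no_stopS i p : no_stop i.+1 p = no_stop i p && ~~ stops p i.
Proof.
apply/forallP/andP => [h|[/forallP h hi] j].
  split; last by apply: (implyP (h i)).
  by apply/forallP => j; apply/implyP => hj; apply: (implyP (h j)); apply: ltnW.
apply/implyP; rewrite ltnS leq_eqVlt => /orP[/eqP/val_inj -> //|hj].
exact: (implyP (h j)).
Qed.

Lemma success_stop p i : no_stop i p -> stops p i ->
  success k.+1 s p = (p i < k.+1)%N.
Proof.
move=> /forallP ns st; apply/existsP/idP => [[j /andP[sel pj]] | pi].
  suff -> : i = j by [].
  case/orP: sel => /andP[h /forallP h']; last by move: (h' i); rewrite st.
  apply/val_inj; case: (ltngtP i j) => // hij.
    by have := implyP (h' i) hij; rewrite st.
  by have := implyP (ns j) hij; rewrite h.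
exists i; rewrite pi andbT /selects st /=; apply/orP; left; exact/forallP.
Qed.

Lemma success_no_stop p : no_stop n p -> success k.+1 s p = (p ord_max < k.+1)%N.
Proof.
move=> /forallP ns.
have nst j : ~~ stops p j.
  have [hj|hj] := ltnP j n; first by apply: (implyP (ns j)).
  by rewrite stopsE ltnNge hj.
apply/existsP/idP => [[j /andP[sel pj]] | pi].
  case/orP: sel => /andP[h _]; first by move: (nst j); rewrite h.
  by suff -> : ord_max = j by []; apply/val_inj/esym/eqP; rewrite -eqSS.
exists ord_max; rewrite pi andbT; apply/orP; right.
by rewrite eqxx /=; apply/forallP.
Qed.

Lemma no_stop_order_inv m : order_inv m (no_stop m).
Proof.
move=> p q h; apply: eq_forallb => j; case: (ltnP j m) => //= hj.
rewrite !stopsE; congr (~~ (_ && (_ <= _)%N)).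
apply: eq_card => x; rewrite !inE; case: (leqP x j) => //= hx.
by rewrite leqNgt h ?(leq_ltn_trans hx) // -leqNgt.
Qed.

Lemma among_best_swap_inv l i : swap_inv i (fun p => among_best l p i).
Proof.
move=> sg p hs; rewrite /among_best permM ((fixes_fromP _ _ hs) i) //.
congr (_ <= _)%N; rewrite -[RHS](@card_perm_filter _ (fun j => j <= i)%N _ sg).
  by apply: eq_card => x; rewrite !inE permM.
move=> j; case: (ltngtP j i) => hj.
- by rewrite ltnW // (fixes_from_lt _ hs).
- by rewrite (fixes_fromP _ _ hs) ?(ltnW hj) // leqNgt hj.
- by rewrite (fixes_fromP _ _ hs) hj ?leqnn.
Qed.

Lemma rank_swap_inv m i : (m <= i)%N -> swap_inv m (fun p => p i < k.+1)%N.
Proof. by move=> mi sg p hs; rewrite permM (fixes_fromP _ _ hs). Qed.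

Local Notation T := (#|[set: 'S_n.+1]|%:R : R).

Lemma card_perms_neq0 : T != 0.
Proof. by rewrite pnatr_eq0 cardsT -lt0n; apply/card_gt0P; exists 1%g. Qed.

(** Given that the first m candidates were passed over, the success probability is [polval] at m,
    whatever their order. *)
Lemma no_stop_success m : (m <= n)%N ->
  #|[set p | no_stop m p && success k.+1 s p]|%:R =
  #|[set p | no_stop m p]|%:R * polval R n k a m.
Proof.
have T0 := card_perms_neq0.
move: m; apply: descending_ind => [|m lt_mn IH].
  have -> : [set p | no_stop n p && success k.+1 s p] =
            [set p | no_stop n p && (p ord_max < k.+1)%N].
    apply/setP => p; rewrite !inE; case: (boolP (no_stop n p)) => //= h.
    by rewrite success_no_stop.
  have kn' : (k.+1 <= n.+1)%N by apply: ltnW.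
  have e1 := order_swap_indep (leqnSn n) (@no_stop_order_inv n) (@rank_swap_inv n ord_max (leqnn n)).
  (* All [k.+1] winners are present at the end, so the last arrival wins with probability
     [k.+1 / n.+1]. *)
  have := nbest_best_count k.+1 (@ord_max n) k.+1.
  have -> : [set p | (nbest k.+1 n.+1 p == k.+1) && (p ord_max < k.+1)%N] = [set p : 'S_n.+1 | (p ord_max < k.+1)%N].
    by apply/setP => p; rewrite !inE nbest_full ?eqxx.
  have -> : [set p : 'S_n.+1 | nbest k.+1 n.+1 p == k.+1] = setT.
    by apply/setP => p; rewrite !inE nbest_full ?eqxx.
  move=> e2.
  have {}e1 := congr1 (fun x => x%:R : R) e1; have {}e2 := congr1 (fun x => x%:R : R) e2.
  rewrite /= !natrM in e1 e2.
  have n0 : n.+1%:R != 0 :> R by rewrite pnatr_eq0.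
  rewrite polval_last; apply: (mulIf T0); apply: (mulIf n0).
  rewrite e1 -[LHS]mulrA [_ * n.+1%:R]mulrC e2; field.
  by rewrite nat1r.
have lt_m : (m < n.+1)%N by apply: ltnW.
pose i := Ordinal lt_m.
have sp (F : pred 'S_n.+1) : #|[set p | no_stop m p && F p]| =
    (#|[set p | no_stop m.+1 p && F p]| + #|[set p | no_stop m p && (among_best (a m.+1) p i && F p)]|)%N.
  rewrite -cardsUI [X in (_ + X)%N](_ : _ = 0%N) ?addn0.
    apply: eq_card => p; rewrite !inE (no_stopS i) stopsE lt_mn /=.
    by case: (no_stop m p) => //=; case: (among_best _ _ _) => //=; rewrite ?orbF.
  apply: eq_card0 => p; rewrite !inE (no_stopS i) stopsE lt_mn /=.
  by case: (among_best _ _ _); rewrite /= ?andbF.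
have e1 := sp (success k.+1 s); have e2 := sp predT.
have eT (E : pred 'S_n.+1) : [set p | E p && predT p] = [set p | E p].
  by apply/setP => p; rewrite !inE andbT.
have eT' : [set p | no_stop m p && (among_best (a m.+1) p i && predT p)] = [set p | no_stop m p && among_best (a m.+1) p i].
  by apply/setP => p; rewrite !inE andbT.
rewrite !eT eT' in e2.
have eacc : [set p | no_stop m p && (among_best (a m.+1) p i && success k.+1 s p)] =
   [set p | no_stop m p && (among_best (a m.+1) p i && (p i < k.+1)%N)].
  apply/setP => p; rewrite !inE; case: (boolP (no_stop m p)) => //= ns.
  case: (boolP (among_best _ _ _)) => //= am.
  by rewrite (@success_stop p i) // stopsE lt_mn.
rewrite eacc in e1.
have mn' : (m <= n.+1)%N by apply: ltnW.
(* Not having stopped depends on the order of the first m arrivals; acceptance and rank of candidate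
   i are unaffected by rearranging them. *)
have i1 := order_swap_indep mn' (@no_stop_order_inv m) (@among_best_swap_inv (a m.+1) i).
have sB : swap_inv m (fun p => among_best (a m.+1) p i && (p i < k.+1)%N).
  move=> sg p hs; congr (_ && _); first exact: (@among_best_swap_inv _ i).
  exact: (@rank_swap_inv m i).
have i2 := order_swap_indep mn' (@no_stop_order_inv m) sB.
have c1 := @among_best_count n i (a m.+1) (ltnW (level_lt (ltn0Sn m))).
have c2 := @accept_count R n k.+1 (ltnW kn) i (a m.+1).
have {}i1 := congr1 (fun x => x%:R : R) i1; have {}i2 := congr1 (fun x => x%:R : R) i2.
have {}c1 := congr1 (fun x => x%:R : R) c1.
rewrite /= !natrM in i1 i2 c1 c2.
have m0 : m.+1%:R != 0 :> R by rewrite pnatr_eq0.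
rewrite polval_step // /dpstep e1 natrD IH.
have {}e2 : #|[set p | no_stop m.+1 p]|%:R = #|[set p | no_stop m p]|%:R - #|[set p | no_stop m p && among_best (a m.+1) p i]|%:R :> R.
  by rewrite e2 natrD addrK.
rewrite e2; exact: (conditional_step _ T0 m0 c1 c2 i1 i2).
Qed.

Lemma success_probE : success_prob R n.+1 k.+1 s = polval R n k a 0.
Proof.
have := no_stop_success (leq0n n).
have ns p : no_stop 0 p by apply/forallP.
have -> : [set p | no_stop 0 p && success k.+1 s p] = [set p | success k.+1 s p].
  by apply/setP => p; rewrite !inE ns.
have -> : [set p | no_stop 0 p] = setT by apply/setP => p; rewrite !inE ns.
by rewrite /success_prob => ->; rewrite mulrAC divff ?mul1r // card_perms_neq0.
Qed.

End SuccessCount.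

(** As [thresholds] is a predicate on t, the first clause ensures that the recursive definition
    succeeds. For the second, both success probabilities are values V_0, compared by
    [polval_opt]. *)
Theorem theorem2 (R : realFieldType) (n k : nat) (hk : (1 <= k)%N)
  (hkn : (k < n)%N) :
  (exists t : nat -> nat, thresholds R n k t) /\
  (forall t : nat -> nat, thresholds R n k t ->
     optimal_seq R n k (fun l : nat => (t l + l - 1)%N)).
Proof.
case: k hk hkn => // k _; case: n => // n; rewrite ltnS => kn; split; first exact: thresholds_exist.
move=> t ht; have adm := threshold_seq_admissible kn ht.
split=> // s' adm'; rewrite !success_probE //.
apply: polval_opt => // j /andP[j0 _].
by rewrite (level_lt adm') // level_le.
Qed.
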